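(* Let $3-2\sqrt2\le B<A\le 1$, let $\lambda,\alpha\in\mathbb{R}$, and put $M=\dfrac{2\lambda\,\Gamma(\alpha+1)}{\sqrt{\pi}\,\Gamma(\alpha+\frac12)}$. Suppose $$\alpha \geq \max\left\{0,\ \frac{|\lambda|}{2}\left|\frac{\lambda(1+A)(1+B)+M(1+B)^2}{A-B}\right|\right\}.$$ Put $$L=(A-B)\left|\alpha\lambda\big(\lambda(A+B)+2MB\big)+\frac{4B\lambda(1-B)}{(1+B)^2}\big(\lambda(1+A)+M(1+B)\big)\right|,$$ $$E=\big(\lambda(1-AB)+M(1-B^2)\big)^2-(1-B^2)\big(\lambda(1-A)+M(1-B)\big)\big(\lambda(1+A)+M(1+B)\big).$$ Suppose that one of the following two alternatives holds. (a) Both $L\ \ge\ \frac{\lambda^2}{2}|E|$ and $$\alpha^2(A-B)^2-\lambda(A-B)\left|\alpha\big(\lambda(A+B)+2MB\big)+\frac{4B(1-B)}{(1+B)^2}\big(\lambda(1+A)+M(1+B)\big)\right|+8\alpha\frac{B(1-B)(A-B)^2}{(1+B)^3}$$ $$\ge\ \frac14\big(\lambda^2(1-A)(1-B)+\lambda M(1-B)^2\big)\big(\lambda^2(1+A)(1+B)+\lambda M(1+B)^2\big).$$ (b) Both $L\ \le\ \frac{\lambda^2}{2}|E|$ and $$\left(\alpha\big(\lambda(A+B)+2MB\big)+\frac{4B(1-B)}{(1+B)^2}\big(\lambda(1+A)+M(1+B)\big)\right)^2\le E\left(\alpha^2+8\alpha B\frac{1-B}{(1+B)^3}-\left(\frac{\lambda^2(1-AB)+\lambda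 M(1-B^2)}{2(A-B)}\right)^2\right).$$ If $(1+B)\,\mathtt{S}_{\alpha,\lambda}(z)\neq 1+A$ for all $z\in\Delta$, then $\mathtt{S}_{\alpha,\lambda}\in\mathcal{P}[A,B]$.
   Context: $\Delta=\{z\in\mathbb{C}:|z|<1\}$. The Bessel-Struve kernel function is, for $\alpha>-\frac12$ and $\lambda\in\mathbb{C}$, $$\mathtt{S}_{\alpha,\lambda}(z)=\sum_{n=0}^\infty \frac{\Gamma(\alpha+1)\,\Gamma\left(\frac{n+1}{2}\right)}{\sqrt{\pi}\,n!\,\Gamma\left(\frac n2+\alpha+1\right)}\lambda^n z^n .$$ For analytic $f,g$ on $\Delta$, $f$ is subordinate to $g$, written $f\prec g$, if there is an analytic self-map $w$ of $\Delta$ with $w(0)=0$ and $f=g\circ w$. For $-1\le B<A\le 1$, $\mathcal{P}[A,B]$ is the class of analytic functions $p(z)=1+c_1z+\cdots$ on $\Delta$ with $p(z)\prec \frac{1+Az}{1+Bz}$. *)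

(* Defs.v *)
From Stdlib Require Import Reals Factorial.
From Coquelicot Require Import Coquelicot.

Open Scope R_scope.

(* Euler's integral; only meaningful for [0 < x], the only arguments used. *)
Definition Gamma (x : R) : R :=
  RInt_gen (fun t : R => Rpower t (x - 1) * exp (- t))
           (at_right 0) (Rbar_locally p_infty).

(* Sum of a complex series: Coquelicot's [Series] is for real terms only.
   Like [RInt], the value is unspecified when the series diverges. *)
Definition CSeries (a : nat -> C) : C :=
  iota (T := C_CompleteNormedModule)
       (fun l : C => @is_series C_AbsRing C_NormedModule a l).

Definition bessel_struve_coef (alpha : R) (n : nat) : R :=
  (Gamma (alpha + 1) * Gamma ((INR n + 1) / 2)) /
  (sqrt PI * INR (fact n) * Gamma (INR n / 2 + alpha + 1)).

Definition bessel_struve (alpha : R) (lambda : C) (z : C) : C :=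
  CSeries (fun n : nat =>
    (RtoC (bessel_struve_coef alpha n) * lambda ^ n * z ^ n)%C).

Definition unit_disk (z : C) : Prop := Cmod z < 1.

(* Complex differentiability at every point of the open disk: the scalars are
   complex here, so this is not real differentiability of a map of the plane. *)
Definition analytic_on_disk (f : C -> C) : Prop :=
  forall z : C, unit_disk z -> @ex_derive C_AbsRing C_NormedModule f z.

Definition subordinate (f g : C -> C) : Prop :=
  exists w : C -> C,
    analytic_on_disk w /\
    (forall z : C, unit_disk z -> unit_disk (w z)) /\
    w (RtoC 0) = RtoC 0 /\
    (forall z : C, unit_disk z -> f z = g (w z)).

Definition janowski_class (A B : R) (p : C -> C) : Prop :=
  analytic_on_disk p /\
  p (RtoC 0) = RtoC 1 /\
  subordinate p
    (fun z : C => ((RtoC 1 + RtoC A * z) / (RtoC 1 + RtoC B * z))%C).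

(* Main.v *)
Require Import Defs.
From Stdlib Require Import Reals Lra Factorial.
From Coquelicot Require Import Coquelicot.
Open Scope R_scope.

(* The coefficients of [S(z)] are nonnegative multiples of [lambda^n] and
   [S(0) = 1], so [|S(z) - 1| <= T(|z|) - 1] where [T(r) = S(r)] or [S(-r)]
   according to the sign of [lambda]. Since [T] is continuous with [T(0) = 1] and
   omits [(1+A)/(1+B)], it stays below that value: [S] maps the disk into the open
   disk of center [1] and radius [(A-B)/(1+B)]. As [B > 0], this disk is contained
   in the image of [(1+Az)/(1+Bz)], and [w = (S-1)/(A-BS)] realizes the
   subordination. *)

(** * Convergence of Euler's integral and bounds on Gamma *)

(** For a nonnegative integrand the integral over [[a, b]] grows with the interval, so it converges
    to its supremum. The supremum form reduces inequalities on the improper integral to proper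
    ones. *)
Lemma is_RInt_gen_lub (f : R -> R) (K : R) :
  (forall t, 0 < t -> 0 <= f t) ->
  (forall t, 0 < t -> continuous f t) ->
  (forall a b, 0 < a <= b -> RInt f a b <= K) ->
  exists l, is_RInt_gen f (at_right 0) (Rbar_locally p_infty) l /\
    is_lub (fun y => exists a b, 0 < a <= b /\ y = RInt f a b) l.
Proof.
  intros Hpos Hcont HK.
  assert (Hex : forall a b, 0 < a <= b -> ex_RInt f a b).
  { intros a b Hab. apply (@ex_RInt_continuous R_CompleteNormedModule). intros t Ht.
    rewrite Rmin_left, Rmax_right in Ht by lra. apply Hcont; lra. }
  destruct (completeness (fun y => exists a b, 0 < a <= b /\ y = RInt f a b))
    as [l Hl].
  - exists K. intros y (a & b & Hab & ->). now apply HK.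
  - exists (RInt f 1 1), 1, 1. split; [lra | reflexivity].
  - exists l. split; [|exact Hl].
    intros P [eps HP].
    assert (Hap : exists a b, 0 < a <= b /\ l - eps < RInt f a b).
    { apply Classical_Prop.NNPP. intros Hn.
      assert (l <= l - eps).
      { apply (proj2 Hl). intros y (a & b & Hab & ->).
        apply Rnot_lt_le. intros Hlt. apply Hn. now exists a, b. }
      generalize (cond_pos eps). lra. }
    destruct Hap as (a0 & b0 & Hab0 & Hlt).
    (* An interval containing [[a0, b0]] has its integral between [l - eps] and [l]. *)
    apply (Filter_prod _ _ _ (fun a => 0 < a <= a0) (fun b => b0 <= b)).
    + exists (mkposreal a0 (proj1 Hab0)). intros a Ha Ha0. split; [exact Ha0|].
      change (Rabs (a - 0) < a0) in Ha. rewrite Rminus_0_r, Rabs_pos_eq in Ha; lra.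
    + exists b0. intros b Hb. lra.
    + intros a b Ha Hb. exists (RInt f a b). split.
      * apply (RInt_correct (V := R_CompleteNormedModule)),  Hex. simpl. lra.
      * apply HP. change (Rabs (RInt f a b - l) < eps).
        assert (RInt f a b <= l).
        { apply (proj1 Hl). exists a, b. split; [lra | reflexivity]. }
        assert (RInt f a0 b0 <= RInt f a b).
        { rewrite <- (RInt_Chasles (V := R_CompleteNormedModule) f a a0 b),
            <- (RInt_Chasles (V := R_CompleteNormedModule) f a0 b0 b);
            try (apply Hex; lra).
          assert (0 <= RInt f a a0).
          { apply RInt_ge_0; [lra | apply Hex; lra |]. intros t Ht. apply Hpos; lra. }
          assert (0 <= RInt f b0 b).
          { apply RInt_ge_0; [lra | apply Hex; lra |]. intros t Ht. apply Hpos; lra. }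
          unfold plus; simpl. lra. }
        apply Rabs_def1; lra.
Qed.

Lemma Gamma_integrand_pos (x t : R) : 0 < Rpower t (x - 1) * exp (- t).
Proof. apply Rmult_lt_0_compat; apply exp_pos. Qed.

Lemma Gamma_integrand_continuous (x t : R) :
  0 < t -> continuous (fun t => Rpower t (x - 1) * exp (- t)) t.
Proof.
  intros Ht. apply (@ex_derive_continuous R_AbsRing R_NormedModule).
  unfold Rpower. auto_derive. exact Ht.
Qed.

Lemma ex_RInt_Gamma_integrand (x a b : R) :
  0 < a <= b -> ex_RInt (fun t => Rpower t (x - 1) * exp (- t)) a b.
Proof.
  intros Hab. apply (@ex_RInt_continuous R_CompleteNormedModule). intros t Ht.
  rewrite Rmin_left, Rmax_right in Ht by lra. apply Gamma_integrand_continuous; lra.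
Qed.

Lemma exp_le_mono (x y : R) : x <= y -> exp x <= exp y.
Proof. intros [H| ->]; [left; now apply exp_increasing | apply Rle_refl]. Qed.

Lemma ln_le_minus_1 (u : R) : 0 < u -> ln u <= u - 1.
Proof.
  intros Hu. rewrite <- (ln_exp (u - 1)). apply ln_le; [exact Hu|].
  generalize (exp_ineq1_le (u - 1)). lra.
Qed.

(* With [q = x + 1/2], [t^(x-1/2) (1+t) <= (1+t)^q], and [(1+t)^q e^(-t)] is
   maximal at [1 + t = q]. *)
Lemma Gamma_integrand_le (x t : R) :
  1 / 2 <= x -> 0 < t ->
  Rpower t (x - 1) * exp (- t)
    <= exp (1 - (x + 1 / 2) + (x + 1 / 2) * ln (x + 1 / 2)) / (sqrt t * (1 + t)).
Proof.
  intros Hx Ht. set (q := x + 1 / 2).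
  assert (Hq : 1 <= q) by (unfold q; lra).
  rewrite <- Rpower_sqrt by exact Ht. rewrite <- (exp_ln (1 + t)) by lra.
  unfold Rpower, Rdiv. rewrite <- !exp_plus, <- exp_Ropp, <- exp_plus.
  apply exp_le_mono.
  assert (Hl : ln t <= ln (1 + t)) by (apply ln_le; lra).
  assert (H := ln_le_minus_1 ((1 + t) / q) ltac:(apply Rdiv_lt_0_compat; lra)).
  rewrite ln_div in H by lra.
  apply (Rmult_le_compat_l q) in H; [|lra].
  replace (q * ((1 + t) / q - 1)) with (1 + t - q) in H by (field; lra).
  assert ((x - 1 / 2) * ln t <= (x - 1 / 2) * ln (1 + t))
    by (apply Rmult_le_compat_l; lra).
  unfold q in *. lra.
Qed.

(** The majorant [C / (sqrt t * (1 + t))] has the primitive [2 * C * atan (sqrt t)], which increases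
    by at most [C * PI] on the half-line. *)
Lemma RInt_Gamma_integrand_le (x a b : R) :
  1 / 2 <= x -> 0 < a <= b ->
  RInt (fun t => Rpower t (x - 1) * exp (- t)) a b
    <= exp (1 - (x + 1 / 2) + (x + 1 / 2) * ln (x + 1 / 2)) * PI.
Proof.
  intros Hx Hab. set (C := exp _).
  assert (HC : 0 < C) by apply exp_pos.
  assert (HI : is_RInt (fun t => C / (sqrt t * (1 + t))) a b
                 (2 * C * atan (sqrt b) - 2 * C * atan (sqrt a))).
  { apply (is_RInt_derive (fun t => 2 * C * atan (sqrt t))
             (fun t => C / (sqrt t * (1 + t)))).
    - intros t Ht. rewrite Rmin_left, Rmax_right in Ht by lra.
      assert (0 < sqrt t) by (apply sqrt_lt_R0; lra).
      assert (Hs : sqrt t * sqrt t = t) by (apply sqrt_sqrt; lra).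
      auto_derive; [lra|]. rewrite Rmult_1_r, Hs. field. lra.
    - intros t Ht. rewrite Rmin_left, Rmax_right in Ht by lra.
      assert (0 < sqrt t) by (apply sqrt_lt_R0; lra).
      apply (@ex_derive_continuous R_AbsRing R_NormedModule).
      auto_derive. repeat split; try lra. apply Rmult_integral_contrapositive; lra. }
  apply Rle_trans with (2 * C * atan (sqrt b) - 2 * C * atan (sqrt a)).
  - rewrite <- (is_RInt_unique _ _ _ _ HI).
    apply RInt_le; [lra | now apply ex_RInt_Gamma_integrand | eexists; exact HI |].
    intros t Ht. apply Gamma_integrand_le; lra.
  - destruct (atan_bound (sqrt b)).
    assert (0 <= atan (sqrt a)).
    { rewrite <- atan_0. destruct (sqrt_pos a) as [Hs|<-]; [|lra].
      left. now apply atan_increasing. }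
    nra.
Qed.

Lemma Gamma_lub (x : R) :
  1 / 2 <= x ->
  is_lub (fun y => exists a b, 0 < a <= b /\
            y = RInt (fun t => Rpower t (x - 1) * exp (- t)) a b) (Gamma x).
Proof.
  intros Hx.
  destruct (is_RInt_gen_lub (fun t => Rpower t (x - 1) * exp (- t))
              (exp (1 - (x + 1 / 2) + (x + 1 / 2) * ln (x + 1 / 2)) * PI))
    as (l & Hl & Hlub).
  - intros t _. left. apply Gamma_integrand_pos.
  - intros t Ht. now apply Gamma_integrand_continuous.
  - intros a b. now apply RInt_Gamma_integrand_le.
  - unfold Gamma. now rewrite (is_RInt_gen_unique _ _ Hl).
Qed.

Lemma RInt_le_Gamma (x a b : R) :
  1 / 2 <= x -> 0 < a <= b ->
  RInt (fun t => Rpower t (x - 1) * exp (- t)) a b <= Gamma x.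
Proof.
  intros Hx Hab. apply (proj1 (Gamma_lub x Hx)). now exists a, b.
Qed.

Lemma Gamma_nonneg (x : R) : 1 / 2 <= x -> 0 <= Gamma x.
Proof.
  intros Hx. generalize (RInt_le_Gamma x 1 1 Hx). rewrite RInt_point.
  intros H. apply H. lra.
Qed.

(** On [[1, 2]] the power is at least 1 and the exponential at least [exp (- 2)]. This uniform bound
    keeps the denominators of the coefficients away from 0. *)
Lemma Gamma_ge_exp_m2 (x : R) : 1 <= x -> exp (- 2) <= Gamma x.
Proof.
  intros Hx. apply Rle_trans with (2 := RInt_le_Gamma x 1 2 ltac:(lra) ltac:(lra)).
  replace (exp (- 2)) with (RInt (fun _ => exp (- 2)) 1 2)
    by (rewrite RInt_const; unfold scal; simpl; unfold mult; simpl; ring).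
  apply RInt_le; [lra | apply ex_RInt_const | apply ex_RInt_Gamma_integrand; lra |].
  intros t Ht. rewrite <- (Rmult_1_l (exp (- 2))).
  apply Rmult_le_compat; [lra | left; apply exp_pos | | apply exp_le_mono; lra].
  apply Rle_trans with (Rpower t 0); [rewrite Rpower_O; lra | apply Rle_Rpower; lra].
Qed.

(** Pointwise, [t^(x-1)] is at most [t^(z-1)] for [t >= 1] and at most [t^(y-1)] for [t < 1], hence
    at most their sum. *)
Lemma Gamma_le_add (x y z : R) :
  1 / 2 <= y -> y <= x <= z -> Gamma x <= Gamma y + Gamma z.
Proof.
  intros Hy Hx. apply (proj2 (Gamma_lub x ltac:(lra))).
  intros ? (a & b & Hab & ->).
  apply Rle_trans with (RInt (fun t => Rpower t (y - 1) * exp (- t)) a b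
                        + RInt (fun t => Rpower t (z - 1) * exp (- t)) a b).
  2: apply Rplus_le_compat; apply RInt_le_Gamma; lra.
  rewrite <- (RInt_plus (V := R_CompleteNormedModule))
    by now apply ex_RInt_Gamma_integrand.
  apply RInt_le; [lra | now apply ex_RInt_Gamma_integrand | |].
  { apply (ex_RInt_plus (V := R_NormedModule)); now apply ex_RInt_Gamma_integrand. }
  intros t Ht. unfold plus; simpl. rewrite <- Rmult_plus_distr_r.
  apply Rmult_le_compat_r; [left; apply exp_pos|].
  assert (Hp : forall u, 0 < Rpower t u) by (intros u; apply exp_pos).
  destruct (Rle_dec 1 t) as [H1|H1].
  - assert (Rpower t (x - 1) <= Rpower t (z - 1)) by (apply Rle_Rpower; lra).
    generalize (Hp (y - 1)). lra.
  - assert (Rpower t (x - 1) <= Rpower t (y - 1)).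
    { unfold Rpower. apply exp_le_mono.
      assert (ln t < 0) by (rewrite <- ln_1; apply ln_increasing; lra). nra. }
    generalize (Hp (z - 1)). lra.
Qed.

(** * The Gaussian integral and the value of Gamma at 1/2 *)

Definition gauss (x : R) : R := RInt (fun u => exp (- u ^ 2)) 0 x.

Lemma gauss_continuous (u : R) : continuous (fun u => exp (- u ^ 2)) u.
Proof.
  apply (@ex_derive_continuous R_AbsRing R_NormedModule). now auto_derive.
Qed.

Lemma ex_RInt_gauss (a b : R) : ex_RInt (fun u => exp (- u ^ 2)) a b.
Proof.
  apply (@ex_RInt_continuous R_CompleteNormedModule). intros; apply gauss_continuous.
Qed.

Lemma is_derive_gauss (x : R) : is_derive gauss x (exp (- x ^ 2)).
Proof.
  apply (@is_derive_RInt R_NormedModule (fun u => exp (- u ^ 2)) gauss 0 x).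
  - apply filter_forall. intros y.
    apply (RInt_correct (V := R_CompleteNormedModule)), ex_RInt_gauss.
  - apply gauss_continuous.
Qed.

(** The companion of [gauss] in the classical evaluation of the Gaussian integral: its derivative is
    opposite to that of [gauss x ^ 2], and it tends to 0 at infinity. *)
Definition gauss_aux (x : R) : R :=
  RInt (fun t => exp (- x ^ 2 * (1 + t ^ 2)) / (1 + t ^ 2)) 0 1.

Lemma ex_RInt_gauss_aux (x : R) :
  ex_RInt (fun t => exp (- x ^ 2 * (1 + t ^ 2)) / (1 + t ^ 2)) 0 1.
Proof.
  apply (@ex_RInt_continuous R_CompleteNormedModule). intros t _.
  apply (@ex_derive_continuous R_AbsRing R_NormedModule). auto_derive. nra.
Qed.

Lemma is_derive_gauss_aux (x : R) :
  is_derive gauss_aux x (- (2 * exp (- x ^ 2) * gauss x)).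
Proof.
  assert (HD : forall t y : R, is_derive (fun z : R => exp (- z ^ 2 * (1 + t ^ 2)) / (1 + t ^ 2)) y
                 (- 2 * y * exp (- y ^ 2 * (1 + t ^ 2)))).
  { intros t y. auto_derive; [nra|]. simpl. field. nra. }
  assert (HI : RInt (fun t => Derive (fun z => exp (- z ^ 2 * (1 + t ^ 2)) / (1 + t ^ 2)) x) 0 1
               = - (2 * exp (- x ^ 2) * gauss x)).
  (* The derivative of the integrand in [x] factors as [-2 exp(-x^2)] times [x exp(-(x t)^2)]; the
     substitution [u = x t] turns the integral of the second factor into [gauss x]. *)
  { assert (H : is_RInt (fun t => scal x (exp (- (x * t + 0) ^ 2))) 0 1 (gauss x)).
    { apply (is_RInt_comp_lin (V := R_NormedModule) (fun u => exp (- u ^ 2))).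
      replace (x * 0 + 0) with 0 by ring. replace (x * 1 + 0) with x by ring.
      apply (RInt_correct (V := R_CompleteNormedModule)), ex_RInt_gauss. }
    apply (is_RInt_scal _ _ _ (- 2 * exp (- x ^ 2))) in H.
    apply (is_RInt_unique (V := R_CompleteNormedModule)) in H.
    etransitivity; [|etransitivity; [exact H|]].
    2: unfold scal; simpl; unfold mult; simpl; ring.
    apply RInt_ext. intros t _.
    rewrite (is_derive_unique _ _ _ (HD t x)).
    unfold scal; simpl; unfold mult; simpl.
    replace (- (x * (x * 1)) * (1 + t * (t * 1)))
      with (- (x * (x * 1)) + - ((x * t + 0) * ((x * t + 0) * 1))) by ring.
    rewrite exp_plus. ring. }
  rewrite <- HI. unfold gauss_aux.
  apply is_derive_RInt_param.
  - apply filter_forall. intros y t _. eexists. apply HD.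
  - intros t _.
    apply continuity_2d_pt_ext with (f := fun u v => - 2 * u * exp (- u ^ 2 * (1 + v ^ 2))).
    { intros u v. symmetry. apply is_derive_unique, HD. }
    apply continuity_2d_pt_mult.
    + apply continuity_2d_pt_mult; [apply continuity_2d_pt_const | apply continuity_2d_pt_id1].
    + apply continuity_1d_2d_pt_comp.
      * apply derivable_continuous_pt, derivable_pt_exp.
      * simpl. repeat first [ apply continuity_2d_pt_mult | apply continuity_2d_pt_plus
          | apply continuity_2d_pt_opp | apply continuity_2d_pt_const
          | apply continuity_2d_pt_id1 | apply continuity_2d_pt_id2 ].
  - apply filter_forall. intros y. apply ex_RInt_gauss_aux.
Qed.

Lemma gauss_aux_0 : gauss_aux 0 = PI / 4.
Proof.
  unfold gauss_aux. apply is_RInt_unique.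
  replace (PI / 4) with (minus (atan 1) (atan 0))
    by (rewrite atan_0, atan_1; unfold minus, plus, opp; simpl; ring).
  apply (is_RInt_derive atan).
  - intros t _. auto_derive; [trivial|].
    replace (- 0 ^ 2 * (1 + t ^ 2)) with 0 by ring. rewrite exp_0.
    simpl. field. nra.
  - intros t _. apply (@ex_derive_continuous R_AbsRing R_NormedModule).
    auto_derive. nra.
Qed.

(** The derivatives of the two terms cancel, so the sum keeps its value at 0. *)
Lemma gauss_sqr_add_aux (x : R) : 0 <= x -> gauss x ^ 2 + gauss_aux x = PI / 4.
Proof.
  intros Hx.
  assert (H0 : gauss 0 = 0) by (unfold gauss; rewrite RInt_point; reflexivity).
  rewrite <- gauss_aux_0.
  replace (gauss_aux 0) with (gauss 0 ^ 2 + gauss_aux 0) by (rewrite H0; ring).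
  destruct Hx as [Hx|<-]; [|reflexivity].
  symmetry. apply (eq_is_derive (fun x => gauss x ^ 2 + gauss_aux x)); [|exact Hx].
  intros t _.
  replace (@zero R_NormedModule) with
    (plus (2 * exp (- t ^ 2) * gauss t) (- (2 * exp (- t ^ 2) * gauss t)))
    by (unfold plus, zero; simpl; ring).
  apply (is_derive_plus (K := R_AbsRing) (V := R_NormedModule)); [|apply is_derive_gauss_aux].
  replace (2 * exp (- t ^ 2) * gauss t) with (INR 2 * exp (- t ^ 2) * gauss t ^ Nat.pred 2)
    by (simpl; ring).
  apply is_derive_pow, is_derive_gauss.
Qed.

Lemma gauss_aux_bounds (x : R) : 0 <= gauss_aux x <= exp (- x ^ 2).
Proof.
  split.
  - apply RInt_ge_0; [lra | apply ex_RInt_gauss_aux |]. intros t _.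
    apply Rdiv_le_0_compat; [left; apply exp_pos | nra].
  - replace (exp (- x ^ 2)) with (RInt (fun _ => exp (- x ^ 2)) 0 1)
      by (rewrite RInt_const; unfold scal; simpl; unfold mult; simpl; ring).
    apply RInt_le; [lra | apply ex_RInt_gauss_aux | apply ex_RInt_const |].
    intros t _. apply Rle_div_l; [nra|].
    apply Rle_trans with (exp (- x ^ 2)); [apply exp_le_mono; nra|].
    rewrite <- (Rmult_1_r (exp (- x ^ 2))) at 1.
    apply Rmult_le_compat_l; [left; apply exp_pos | nra].
Qed.

(** This is the substitution [t = u^2]. *)
Lemma RInt_Gamma_half (a b : R) :
  0 < a <= b ->
  RInt (fun t => Rpower t (1 / 2 - 1) * exp (- t)) a b
    = 2 * gauss (sqrt b) - 2 * gauss (sqrt a).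
Proof.
  intros Hab. apply is_RInt_unique.
  apply (is_RInt_derive (fun t => 2 * gauss (sqrt t))
           (fun t => Rpower t (1 / 2 - 1) * exp (- t))).
  - intros t Ht. rewrite Rmin_left, Rmax_right in Ht by lra.
    assert (0 < sqrt t) by (apply sqrt_lt_R0; lra).
    replace (Rpower t (1 / 2 - 1) * exp (- t))
      with (scal 2 (scal (/ (2 * sqrt t)) (exp (- sqrt t ^ 2)))).
    + apply (is_derive_scal (fun t => gauss (sqrt t))).
      apply (is_derive_comp (K := R_AbsRing) (V := R_NormedModule) gauss sqrt);
        [apply is_derive_gauss|].
      apply is_derive_Reals. apply derivable_pt_lim_sqrt. lra.
    + unfold scal; simpl; unfold mult; simpl.
      replace (1 / 2 - 1) with (- (/ 2)) by field.
      rewrite Rpower_Ropp, Rpower_sqrt by lra.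
      rewrite Rmult_1_r, sqrt_sqrt by lra. field. lra.
  - intros t Ht. rewrite Rmin_left, Rmax_right in Ht by lra.
    apply Gamma_integrand_continuous. lra.
Qed.

Lemma gauss_bounds (a : R) : 0 <= a -> 0 <= gauss a <= a.
Proof.
  intros Ha. split.
  - apply RInt_ge_0; [exact Ha | apply ex_RInt_gauss |]. intros; left; apply exp_pos.
  - replace a with (RInt (fun _ => 1) 0 a) at 2
      by (rewrite RInt_const; unfold scal; simpl; unfold mult; simpl; ring).
    apply RInt_le; [exact Ha | apply ex_RInt_gauss | apply ex_RInt_const |].
    intros u _. rewrite <- exp_0. apply exp_le_mono. nra.
Qed.

Lemma Gamma_half : Gamma (1 / 2) = sqrt PI.
Proof.
  destruct (Gamma_lub (1 / 2)) as [Hub Hlub]; [lra|].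
  set (l := Gamma (1 / 2)) in *.
  assert (HPI := PI_RGT_0).
  assert (Hl0 : 0 <= l) by (apply Gamma_nonneg; lra).
  apply Rle_antisym.
  (* Upper bound: [gauss_aux] is nonnegative, so [(2 * gauss (sqrt b))^2 <= PI]. *)
  - apply Hlub. intros ? (a & b & Hab & ->). rewrite RInt_Gamma_half by exact Hab.
    assert (Ha := gauss_bounds (sqrt a) (sqrt_pos a)).
    assert (Hb := gauss_bounds (sqrt b) (sqrt_pos b)).
    assert (He := gauss_sqr_add_aux (sqrt b) (sqrt_pos b)).
    assert (Hx := gauss_aux_bounds (sqrt b)).
    apply Rle_trans with (2 * gauss (sqrt b)); [lra|].
    rewrite <- (sqrt_Rsqr (2 * gauss (sqrt b))) by lra.
    apply sqrt_le_1_alt. unfold Rsqr. nra.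
  - assert (Hg : forall b, 0 < b -> 2 * gauss b <= l).
    { intros b Hb. apply le_epsilon. intros e He.
      (* Since [gauss a <= a], this choice makes the lower-end contribution [2 * gauss a] at most
         [e]. *)
      set (a := Rmin b (e / 2)).
      assert (Ha : 0 < a) by (apply Rmin_glb_lt; lra).
      assert (Hab : a <= b) by apply Rmin_l.
      assert (Hae : a <= e / 2) by apply Rmin_r.
      assert (H : 2 * gauss (sqrt (b ^ 2)) - 2 * gauss (sqrt (a ^ 2)) <= l).
      { rewrite <- RInt_Gamma_half by nra. apply Hub. exists (a ^ 2), (b ^ 2).
        split; [nra | reflexivity]. }
      rewrite !sqrt_pow2 in H by lra.
      generalize (gauss_bounds a ltac:(lra)). lra. }
    rewrite <- (sqrt_Rsqr l) by exact Hl0. apply sqrt_le_1_alt.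
    (* If [l^2 < PI], then [gauss_aux b >= d > 0] for every [b > 0]. For [b = 1 + / d] this
       contradicts [gauss_aux b <= exp (- b^2)], because [exp (b^2) >= 1 + b^2 > / d]. *)
    apply Rnot_lt_le. intros Hlt. set (d := (PI - Rsqr l) / 4).
    assert (Hd : 0 < d) by (unfold d; lra).
    set (b := 1 + / d).
    assert (Hd' := Rinv_0_lt_compat d Hd).
    assert (Hb : 1 < b) by (unfold b; lra).
    assert (H1 := Hg b ltac:(lra)).
    assert (H2 := gauss_sqr_add_aux b ltac:(lra)).
    assert (H3 := gauss_aux_bounds b).
    assert (H4 := gauss_bounds b ltac:(lra)).
    assert (H5 : d <= exp (- b ^ 2)) by (unfold d, Rsqr; nra).
    rewrite exp_Ropp in H5.
    assert (H6 : / d < exp (b ^ 2)).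
    { apply Rlt_le_trans with (1 + b ^ 2); [unfold b in *; nra | apply exp_ineq1_le]. }
    assert (H7 := Rinv_lt_contravar (/ d) (exp (b ^ 2))
             ltac:(apply Rmult_lt_0_compat; [lra | apply exp_pos]) H6).
    rewrite Rinv_inv in H7. lra.
Qed.

(** * Convergence and comparison of complex series *)

Lemma is_series_C_unique (a : nat -> C) (l1 l2 : C) :
  @is_series C_AbsRing C_NormedModule a l1 ->
  @is_series C_AbsRing C_NormedModule a l2 -> l1 = l2.
Proof. apply (@filterlim_locally_unique nat C_AbsRing C_NormedModule eventually _). Qed.

Lemma CSeries_unique (a : nat -> C) (l : C) :
  @is_series C_AbsRing C_NormedModule a l -> CSeries a = l.
Proof.
  intros Ha. apply (@iota_unique C_AbsRing C_CompleteNormedModule); [|exact Ha].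
  intros y Hy. exact (is_series_C_unique a y l Hy Ha).
Qed.

(** A summable majorant gives a sum by completeness; uniqueness identifies it with the value chosen
    by [iota]. *)
Lemma CSeries_correct (a : nat -> C) (b : nat -> R) :
  (forall n, Cmod (a n) <= b n) -> ex_series b ->
  @is_series C_AbsRing C_NormedModule a (CSeries a).
Proof.
  intros Hab Hb.
  destruct (@ex_series_le C_AbsRing C_CompleteNormedModule a b Hab Hb) as [l Hl].
  now rewrite (CSeries_unique a l Hl).
Qed.

Lemma Cmod_is_series_le (a : nat -> C) (b : nat -> R) (l : C) (s : R) :
  (forall n, Cmod (a n) <= b n) ->
  @is_series C_AbsRing C_NormedModule a l -> is_series b s -> Cmod l <= s.
Proof.
  intros Hab Ha Hb.
  apply (is_lim_seq_le (fun n => Cmod (@sum_n C_AbelianMonoid a n)) (sum_n b) (Cmod l) s).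
  - intros n. induction n as [|n IHn].
    + rewrite !sum_O. apply Hab.
    + rewrite !sum_Sn. apply Rle_trans with (1 := Cmod_triangle _ _).
      apply Rplus_le_compat; [exact IHn | apply Hab].
  - apply (filterlim_comp _ _ _ (@sum_n C_AbelianMonoid a) Cmod _ _ _ Ha).
    apply (@filterlim_norm C_AbsRing C_NormedModule l).
  - exact Hb.
Qed.

Lemma is_series_RtoC (u : nat -> R) (s : R) :
  is_series u s ->
  @is_series C_AbsRing C_NormedModule (fun n => RtoC (u n)) (RtoC s).
Proof.
  intros Hu.
  apply (filterlim_ext (fun n => RtoC (sum_n u n))).
  { intros n. induction n as [|n IHn].
    - now rewrite !sum_O.
    - rewrite !sum_Sn, <- IHn. apply RtoC_plus. }
  apply (filterlim_comp _ _ _ (sum_n u) RtoC _ _ _ Hu).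
  intros P [eps HP]. exists eps. intros y Hy. apply HP. split; [exact Hy|].
  apply (ball_center (M := R_UniformSpace) 0 eps).
Qed.

(** * Complex derivatives of power series and Möbius maps *)

Lemma is_C_derive_of_quadratic (f : C -> C) (x l : C) (K delta : R) :
  0 < delta -> 0 <= K ->
  (forall y, Cmod (y - x) < delta ->
     Cmod (f y - f x - (y - x) * l)%C <= K * Cmod (y - x) ^ 2) ->
  @is_derive C_AbsRing C_NormedModule f x l.
Proof.
  intros Hd HK Hf. split; [apply is_linear_scal_l|].
  intros x' Hx' eps.
  rewrite <- (@is_filter_lim_locally_unique C_AbsRing
                (AbsRing_NormedModule C_AbsRing) x x' Hx').
  assert (He := cond_pos eps).
  (* Within this radius [K * m^2 <= eps * m]; the [+ 1] covers [K = 0]. *)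
  assert (HeK : 0 < eps / (K + 1)) by (apply Rdiv_lt_0_compat; lra).
  exists (mkposreal (Rmin delta (eps / (K + 1))) (Rmin_pos _ _ Hd HeK)).
  intros y Hy. change (Cmod (y - x) < Rmin delta (eps / (K + 1))) in Hy.
  change (Cmod (f y - f x - (y - x) * l)%C <= eps * Cmod (y - x)).
  assert (Hy1 := Rlt_le_trans _ _ _ Hy (Rmin_l _ _)).
  assert (Hy2 := Rlt_le_trans _ _ _ Hy (Rmin_r _ _)).
  apply Rle_trans with (1 := Hf y Hy1).
  assert (H0 := Cmod_ge_0 (y - x)). set (m := Cmod (y - x)) in *.
  apply Rlt_div_r in Hy2; [|lra]. simpl. nra.
Qed.

(* [C_NormedModule] carries the product uniform structure and
   [AbsRing_NormedModule C_AbsRing] that of the modulus: not convertible. *)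
Lemma is_derive_C_AbsRing (f : C -> C) (x l : C) :
  @is_derive C_AbsRing C_NormedModule f x l ->
  @is_derive C_AbsRing (AbsRing_NormedModule C_AbsRing) f x l.
Proof. intros [_ H]. split; [apply is_linear_scal_l | exact H]. Qed.

(** The remainder of order [n + 1] is [w] times the one of order [n] plus [n z^(n-1) (w-z)^2]. In
    the closed disk each step thus adds at most [n |w-z|^2], within the growth of [n^2]. At [n = 0]
    the factor [INR n] makes the truncated predecessor harmless. *)
Lemma Cpow_taylor2_le (z w : C) (n : nat) :
  Cmod z <= 1 -> Cmod w <= 1 ->
  Cmod (w ^ n - z ^ n - (w - z) * (INR n * z ^ Nat.pred n))%C
    <= INR n ^ 2 * Cmod (w - z) ^ 2.
Proof.
  intros Hz Hw. assert (Hh := Cmod_ge_0 (w - z)).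
  induction n as [|n IHn].
  - replace (w ^ 0 - z ^ 0 - (w - z) * (INR 0 * z ^ Nat.pred 0))%C with (RtoC 0)
      by (simpl; ring).
    rewrite Cmod_0. simpl. nra.
  - replace (w ^ S n - z ^ S n - (w - z) * (INR (S n) * z ^ Nat.pred (S n)))%C
      with (w * (w ^ n - z ^ n - (w - z) * (INR n * z ^ Nat.pred n))
            + INR n * z ^ Nat.pred n * ((w - z) * (w - z)))%C.
    2:{ rewrite S_INR, RtoC_plus. destruct n as [|n]; simpl; ring. }
    apply Rle_trans with (1 := Cmod_triangle _ _).
    rewrite !Cmod_mult, Cmod_R, Cmod_pow, S_INR.
    assert (Hn := pos_INR n). rewrite (Rabs_pos_eq (INR n)) by exact Hn.
    assert (Hzn : 0 <= Cmod z ^ Nat.pred n <= 1).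
    { split; [apply pow_le, Cmod_ge_0|]. rewrite <- (pow1 (Nat.pred n)).
      apply pow_incr. split; [apply Cmod_ge_0 | exact Hz]. }
    set (e := Cmod (w ^ n - _ - _)%C) in *. set (h := Cmod (w - z)) in *.
    assert (He : 0 <= e) by apply Cmod_ge_0.
    assert (H1 : Cmod w * e <= 1 * e) by (apply Rmult_le_compat_r; lra).
    assert (H2 : INR n * Cmod z ^ Nat.pred n <= INR n * 1)
      by (apply Rmult_le_compat_l; lra).
    assert (H3 : INR n * Cmod z ^ Nat.pred n * (h * h) <= INR n * 1 * (h * h))
      by (apply Rmult_le_compat_r; [nra | exact H2]).
    assert (0 <= INR n * (h * h)) by (apply Rmult_le_pos; nra).
    simpl in *. nra.
Qed.

Lemma Cmod_coef_pow_le (c z : C) (n : nat) :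
  Cmod z <= 1 -> Cmod (c * z ^ n) <= Cmod c.
Proof.
  intros Hz. rewrite Cmod_mult, Cmod_pow.
  assert (Cmod z ^ n <= 1).
  { rewrite <- (pow1 n). apply pow_incr. split; [apply Cmod_ge_0 | exact Hz]. }
  generalize (Cmod_ge_0 c). nra.
Qed.

(** The weight [1 + n^2] dominates the weights 1, [n] and [n^2] of the series, of its formal
    derivative and of the termwise quadratic remainders. Summing the latter bounds the total
    remainder by [s |y-z|^2]. *)
Lemma analytic_power_series (c : nat -> C) :
  ex_series (fun n => (1 + INR n ^ 2) * Cmod (c n)) ->
  analytic_on_disk (fun z => CSeries (fun n => (c n * z ^ n)%C)).
Proof.
  intros Hc z Hz. unfold unit_disk in Hz.
  assert (Hsq : forall n, 0 <= INR n ^ 2) by (intros n; apply pow2_ge_0).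
  assert (Hs : forall y, Cmod y < 1 -> @is_series C_AbsRing C_NormedModule
              (fun n => c n * y ^ n)%C (CSeries (fun n => c n * y ^ n)%C)).
  { intros y Hy. apply CSeries_correct with (2 := Hc). intros n.
    apply Rle_trans with (1 := Cmod_coef_pow_le (c n) y n (Rlt_le _ _ Hy)).
    generalize (Hsq n) (Cmod_ge_0 (c n)). nra. }
  assert (Hg : @is_series C_AbsRing C_NormedModule
              (fun n => c n * INR n * z ^ Nat.pred n)%C
              (CSeries (fun n => c n * INR n * z ^ Nat.pred n)%C)).
  { apply CSeries_correct with (2 := Hc). intros n.
    apply Rle_trans with (1 := Cmod_coef_pow_le _ z _ (Rlt_le _ _ Hz)).
    rewrite Cmod_mult, Cmod_R, Rabs_pos_eq, Rmult_comm by apply pos_INR.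
    apply Rmult_le_compat_r; [apply Cmod_ge_0 | nra]. }
  destruct Hc as [s Hc].
  assert (H0 : 0 <= s).
  { apply (Cmod_is_series_le (fun _ => RtoC 0) _ (RtoC 0) s) in Hc.
    - now rewrite Cmod_0 in Hc.
    - intros n. rewrite Cmod_0. apply Rmult_le_pos; [|apply Cmod_ge_0].
      generalize (Hsq n). lra.
    - apply (is_series_RtoC (fun _ => 0)).
      apply (filterlim_ext (fun _ => 0)); [|apply filterlim_const].
      intros n. rewrite sum_n_const. ring. }
  exists (CSeries (fun n => c n * INR n * z ^ Nat.pred n)%C).
  (* The radius [1 - Cmod z] keeps [y] in the unit disk. *)
  apply (is_C_derive_of_quadratic _ z _ s (1 - Cmod z)); [lra | exact H0 |].
  intros y Hyz.
  assert (Hy : Cmod y < 1).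
  { replace y with (y - z + z)%C by ring.
    apply Rle_lt_trans with (1 := Cmod_triangle _ _). lra. }
  rewrite Rmult_comm.
  apply (Cmod_is_series_le
           (fun n => c n * (y ^ n - z ^ n - (y - z) * (INR n * z ^ Nat.pred n)))%C
           (fun n => Cmod (y - z) ^ 2 * ((1 + INR n ^ 2) * Cmod (c n)))).
  - intros n. rewrite Cmod_mult.
    assert (H := Cpow_taylor2_le z y n (Rlt_le _ _ Hz) (Rlt_le _ _ Hy)).
    apply (Rmult_le_compat_l (Cmod (c n))) in H; [|apply Cmod_ge_0].
    apply Rle_trans with (1 := H).
    assert (0 <= Cmod (c n) * Cmod (y - z) ^ 2)
      by (apply Rmult_le_pos; [apply Cmod_ge_0 | apply pow2_ge_0]).
    lra.
  - assert (H := @is_series_minus C_AbsRing C_NormedModule _ _ _ _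
             (@is_series_minus C_AbsRing C_NormedModule _ _ _ _ (Hs y Hy) (Hs z Hz))
             (@is_series_scal C_AbsRing C_NormedModule (y - z)%C _ _ Hg)).
    revert H. apply is_series_ext. intros n.
    unfold minus, plus, opp, scal; simpl; unfold mult; simpl. ring.
  - apply (is_series_scal (V := R_NormedModule)). exact Hc.
Qed.

(** The first-order remainder is exactly [b (a-b) (y-x)^2 / ((a - b y) D^2)], and
    [|a - b y| >= |D| / 2] near [x]; hence the constant [2 k / |D|^3]. *)
Lemma is_derive_moebius (a b : R) (x : C) :
  (RtoC a - b * x)%C <> RtoC 0 ->
  @is_derive C_AbsRing C_NormedModule
    (fun s => (s - 1) / (RtoC a - b * s))%C x
    ((RtoC a - b) / ((RtoC a - b * x) * (RtoC a - b * x)))%C.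
Proof.
  intros Hx. set (D := (RtoC a - b * x)%C) in *.
  assert (HD : 0 < Cmod D) by now apply Cmod_gt_0.
  assert (Hb := Rabs_pos b).
  assert (Hd : 0 < Cmod D / (2 * (Rabs b + 1))) by (apply Rdiv_lt_0_compat; lra).
  set (k := Cmod (RtoC b * (RtoC a - b))).
  apply (is_C_derive_of_quadratic _ x _ (2 * k / Cmod D ^ 3) _ Hd).
  { apply Rdiv_le_0_compat; [|now apply pow_lt].
    generalize (Cmod_ge_0 (RtoC b * (RtoC a - b))). fold k. lra. }
  intros y Hy. assert (Hm := Cmod_ge_0 (y - x)).
  assert (HDy : Cmod D / 2 <= Cmod (RtoC a - b * y)).
  { assert (H := Cmod_triangle (RtoC a - b * y) (b * (y - x))).
    replace (RtoC a - b * y + b * (y - x))%C with D in H by (unfold D; ring).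
    rewrite (Cmod_mult b), Cmod_R in H.
    apply Rlt_div_r in Hy; [|lra]. nra. }
  assert (Hy0 : (RtoC a - b * y)%C <> RtoC 0) by (apply Cmod_gt_0; lra).
  replace ((y - 1) / (RtoC a - b * y) - (x - 1) / (RtoC a - b * x)
           - (y - x) * ((RtoC a - b) / (D * D)))%C
    with (RtoC b * (RtoC a - b) * ((y - x) * (y - x)) / ((RtoC a - b * y) * (D * D)))%C
    by (unfold D in *; field; split; assumption).
  rewrite Cmod_div, Cmod_mult, !Cmod_mult.
  2:{ repeat apply Cmult_neq_0; assumption. }
  rewrite <- (Cmod_mult b). fold k.
  assert (Hk : 0 <= k) by apply Cmod_ge_0.
  set (e := Cmod (y - x)) in *. set (m := Cmod D) in *.
  apply Rle_div_l; [apply Rmult_lt_0_compat; nra|].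
  apply Rle_trans with (2 * k / m ^ 3 * e ^ 2 * (m / 2 * (m * m))).
  - right. field. lra.
  - apply Rmult_le_compat_l; [|apply Rmult_le_compat_r; nra].
    apply Rmult_le_pos; [|nra]. apply Rdiv_le_0_compat; [lra | now apply pow_lt].
Qed.

(** * Nonnegative coefficients and the Janowski class *)

(** Absorbs the polynomial weight into an exponential series with [lambda] scaled by 3. *)
Lemma one_add_sqr_le_pow3 (n : nat) : 1 + INR n ^ 2 <= 3 ^ n.
Proof.
  induction n as [|n IHn]; [simpl; lra|].
  rewrite S_INR, <- (tech_pow_Rmult 3). assert (H := pow2_ge_0 (INR n - 1)). nra.
Qed.

(** Separates the geometric argument from the Gamma function. *)
Lemma janowski_of_nonneg_coef (A B : R) (u : nat -> R) (lambda : R) :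
  0 <= B -> B < A ->
  (forall n, 0 <= u n) -> u 0%nat = 1 ->
  ex_series (fun n => (1 + INR n ^ 2) * (u n * Rabs lambda ^ n)) ->
  (forall z, unit_disk z ->
     ((RtoC 1 + RtoC B) * CSeries (fun n => RtoC (u n) * RtoC lambda ^ n * z ^ n))%C
       <> (RtoC 1 + RtoC A)%C) ->
  janowski_class A B (fun z => CSeries (fun n => RtoC (u n) * RtoC lambda ^ n * z ^ n)%C).
Proof.
  intros HB HBA Hu Hu0 Hsum Homit.
  set (t := fun n => u n * Rabs lambda ^ n) in *.
  set (f := fun z : C => CSeries (fun n => RtoC (u n) * RtoC lambda ^ n * z ^ n)%C) in *.
  assert (Ht : forall n, 0 <= t n).
  { intros n. apply Rmult_le_pos; [apply Hu | apply pow_le, Rabs_pos]. }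
  assert (Ht0 : t 0%nat = 1) by (unfold t; rewrite Hu0; simpl; ring).
  assert (Hc : forall n, Cmod (RtoC (u n) * RtoC lambda ^ n) = t n).
  { intros n. rewrite Cmod_mult, Cmod_pow, !Cmod_R.
    now rewrite (Rabs_pos_eq (u n)) by apply Hu. }
  assert (Hterm : forall n, t n <= (1 + INR n ^ 2) * t n).
  { intros n. generalize (Ht n) (pow2_ge_0 (INR n)). nra. }
  assert (Htr : forall r, 0 <= r <= 1 -> ex_series (fun n => t n * r ^ n)).
  { intros r Hr. apply (@ex_series_le R_AbsRing R_CompleteNormedModule) with (2 := Hsum).
    intros n. change (Rabs (t n * r ^ n) <= (1 + INR n ^ 2) * t n).
    assert (0 <= r ^ n <= 1).
    { split; [now apply pow_le|]. rewrite <- (pow1 n). now apply pow_incr. }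
    rewrite Rabs_pos_eq by (apply Rmult_le_pos; [apply Ht | lra]).
    generalize (Ht n) (Hterm n). nra. }
  assert (Hterms : forall z n, Cmod (RtoC (u n) * RtoC lambda ^ n * z ^ n) = t n * Cmod z ^ n).
  { intros z n. now rewrite Cmod_mult, Hc, Cmod_pow. }
  assert (Hf : forall z, Cmod z < 1 -> @is_series C_AbsRing C_NormedModule
            (fun n => RtoC (u n) * RtoC lambda ^ n * z ^ n)%C (f z)).
  { intros z Hz. apply (CSeries_correct _ (fun n => t n * Cmod z ^ n)).
    - intros n. right. apply Hterms.
    - apply Htr. split; [apply Cmod_ge_0 | lra]. }
  assert (HT : forall r, 0 <= r <= 1 -> is_series (fun n => t n * r ^ n) (PSeries t r)).
  { intros r Hr. apply Series_correct, Htr, Hr. }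
  assert (HT0 : PSeries t 0 = 1) by now rewrite PSeries_0.
  (* Both constant terms are 1, so the series are compared from index 1 on. *)
  assert (HfT : forall z, Cmod z < 1 -> Cmod (f z - 1) <= PSeries t (Cmod z) - 1).
  { intros z Hz. assert (H0 := Cmod_ge_0 z).
    apply (Cmod_is_series_le (fun n => RtoC (u (S n)) * RtoC lambda ^ S n
               * z ^ S n)%C (fun n => t (S n) * Cmod z ^ S n)).
    - intros n. right. apply Hterms.
    - apply (@is_series_incr_1 C_AbsRing C_NormedModule
               (fun n => RtoC (u n) * RtoC lambda ^ n * z ^ n)%C (f z - 1)%C).
      replace (plus _ _) with (f z); [now apply Hf|].
      rewrite Hu0. unfold plus; simpl. ring.
    - apply (is_series_incr_1 (fun n => t n * Cmod z ^ n)).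
      replace (plus _ _) with (PSeries t (Cmod z)); [apply HT; lra|].
      rewrite Ht0. unfold plus; simpl. ring. }
  assert (Hreal : forall r, 0 <= r < 1 -> exists z, Cmod z < 1 /\ f z = RtoC (PSeries t r)).
  { intros r Hr.
    (* The majorant at [r] is the value of [f] at [s * r], with [s] the sign of [lambda]; this
       transfers the omitted value to the majorant. *)
    assert (Hs : exists s, Rabs s = 1 /\ lambda * s = Rabs lambda).
    { destruct (Rle_dec 0 lambda) as [H|H].
      - exists 1. rewrite Rabs_R1, Rabs_pos_eq by exact H. lra.
      - exists (- 1). rewrite !Rabs_left by lra. lra. }
    destruct Hs as (s & Hs1 & Hs).
    assert (Hz : Cmod (RtoC (s * r)) < 1)
      by (rewrite Cmod_R, Rabs_mult, Hs1, Rabs_pos_eq; lra).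
    exists (RtoC (s * r)). split; [exact Hz|].
    apply (is_series_C_unique _ _ _ (Hf _ Hz)).
    apply (is_series_ext (fun n => RtoC (t n * r ^ n))).
    - intros n. rewrite <- !RtoC_pow, <- !RtoC_mult. f_equal.
      unfold t. rewrite <- Hs, !Rpow_mult_distr. ring.
    - apply is_series_RtoC, HT. lra. }
  assert (Hcont : forall r, 0 <= r < 1 -> continuity_pt (PSeries t) r).
  { intros r Hr. apply PSeries_continuity. rewrite Rabs_pos_eq by lra.
    apply Rbar_lt_le_trans with (Finite 1); [apply Hr|].
    apply Rbar_not_lt_le. intros Hlt.
    apply (CV_disk_outside t 1).
    - now rewrite Rabs_R1.
    - apply ex_series_lim_0, Htr. lra. }
  set (q := (1 + A) / (1 + B)).
  assert (Hq : (1 + B) * q = 1 + A) by (unfold q; field; lra).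
  assert (Hlt : forall r, 0 <= r < 1 -> PSeries t r < q).
  { intros r Hr. apply Rnot_le_lt. intros Hle.
    assert (Hx : exists x, 0 <= x < 1 /\ PSeries t x = q).
    { destruct Hle as [Hlt|Heq]; [|now exists r].
      assert (Hr0 : 0 < r).
      { destruct Hr as [[H|<-] _]; [exact H|]. rewrite HT0 in Hlt. nra. }
      destruct (Ranalysis5.IVT_interv (fun x => PSeries t x - q) 0 r) as (x & Hx & Hxq).
      - intros x Hx. apply continuity_pt_minus; [apply Hcont; lra|].
        apply continuity_pt_const. now intros ? ?.
      - exact Hr0.
      - rewrite HT0. nra.
      - lra.
      - exists x. split; lra. }
    destruct Hx as (x & Hx & Hxq). destruct (Hreal x Hx) as (z & Hz & Hfz).
    apply (Homit z Hz). fold (f z). rewrite Hfz, Hxq, <- !RtoC_plus, <- RtoC_mult.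
    now rewrite Hq. }
  assert (Hball : forall z, Cmod z < 1 -> (1 + B) * Cmod (f z - 1) < A - B).
  { intros z Hz. assert (H := HfT z Hz).
    assert (H' := Hlt (Cmod z) (conj (Cmod_ge_0 z) Hz)). nra. }
  assert (Hden : forall z, Cmod z < 1 -> Cmod (f z - 1) < Cmod (A - B * f z)).
  { intros z Hz. assert (H := Hball z Hz).
    (* The two terms add up to [A - B], so [|A - B f| >= (A - B) - B |f - 1|], which exceeds
       [|f - 1|] by [Hball]. *)
    assert (H' := Cmod_triangle (A - B * f z) (B * (f z - 1))).
    replace (A - B * f z + B * (f z - 1))%C with (RtoC (A - B)) in H'
      by (rewrite RtoC_minus; ring).
    rewrite Cmod_mult, !Cmod_R, !Rabs_pos_eq in H' by lra. lra. }
  assert (Hden0 : forall z, Cmod z < 1 -> (RtoC A - B * f z)%C <> RtoC 0).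
  { intros z Hz. apply Cmod_gt_0. generalize (Hden z Hz) (Cmod_ge_0 (f z - 1)). lra. }
  assert (Hf0 : f (RtoC 0) = RtoC 1).
  { assert (Hz : Cmod 0 < 1) by (rewrite Cmod_0; lra).
    assert (H := HfT _ Hz). rewrite Cmod_0, HT0 in H.
    assert (H0 : (f 0 - 1)%C = RtoC 0).
    { apply Cmod_eq_0. generalize (Cmod_ge_0 (f 0 - 1)). lra. }
    replace (f 0) with (f 0 - 1 + 1)%C by ring. rewrite H0. ring. }
  assert (Hfan : analytic_on_disk f).
  { apply analytic_power_series. revert Hsum. apply ex_series_ext.
    intros n. now rewrite Hc. }
  split; [exact Hfan | split; [exact Hf0|]].
  exists (fun z => (f z - 1) / (RtoC A - B * f z))%C. repeat split.
  - intros z Hz. destruct (Hfan z Hz) as [l Hl].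
    eexists. apply (@is_derive_comp C_AbsRing C_NormedModule
      (fun s => (s - 1) / (RtoC A - B * s))%C f z).
    + apply is_derive_moebius. now apply Hden0.
    + apply is_derive_C_AbsRing, Hl.
  - intros z Hz. unfold unit_disk. rewrite Cmod_div by now apply Hden0.
    assert (H := Hden z Hz). assert (H0 := Cmod_ge_0 (f z - 1)).
    apply Rlt_div_l; lra.
  - rewrite Hf0. unfold Cdiv. ring.
  - intros z Hz.
    assert (HAB : (RtoC A - B)%C <> RtoC 0).
    { rewrite <- RtoC_minus. intros H. apply RtoC_inj in H. lra. }
    (* The other denominator, that of [1 + B w], simplifies to [A - B]. *)
    field. split; [now apply Hden0|].
    intros H. apply HAB. rewrite <- H. ring.
Qed.

(** * Bessel-Struve coefficients and conclusion *)

(** The value of Gamma at 1/2 cancels [sqrt PI]. *)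
Lemma bessel_struve_coef_0 (alpha : R) : 0 <= alpha -> bessel_struve_coef alpha 0 = 1.
Proof.
  intros Ha. unfold bessel_struve_coef.
  replace ((INR 0 + 1) / 2) with (1 / 2) by (simpl; field).
  replace (INR 0 / 2 + alpha + 1) with (alpha + 1) by (simpl; field).
  rewrite Gamma_half. simpl.
  assert (H := Gamma_ge_exp_m2 (alpha + 1) ltac:(lra)).
  assert (H' := exp_pos (- 2)). assert (H2 := sqrt_lt_R0 _ PI_RGT_0).
  field. lra.
Qed.

(** As [1/2 <= (n+1)/2 <= n/2 + alpha + 1], the Gamma factor [m] of the numerator is at most
    [sqrt PI + d]; with [d >= exp (- 2)], the quotient [m / d] is bounded uniformly in [n]. *)
Lemma bessel_struve_coef_bounds (alpha : R) :
  0 <= alpha ->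
  exists K, forall n, 0 <= bessel_struve_coef alpha n <= K * / INR (fact n).
Proof.
  intros Ha. assert (H2 := sqrt_lt_R0 _ PI_RGT_0). assert (He := exp_pos (- 2)).
  set (g := Gamma (alpha + 1)).
  assert (Hg : exp (- 2) <= g) by (apply Gamma_ge_exp_m2; lra).
  exists (g / sqrt PI * (sqrt PI / exp (- 2) + 1)). intros n.
  assert (Hn := pos_INR n). assert (Hf := INR_fact_lt_0 n).
  set (d := Gamma (INR n / 2 + alpha + 1)).
  assert (Hd : exp (- 2) <= d) by (apply Gamma_ge_exp_m2; lra).
  set (m := Gamma ((INR n + 1) / 2)).
  assert (Hm0 : 0 <= m) by (apply Gamma_nonneg; lra).
  assert (Hm : m <= sqrt PI + d).
  { rewrite <- Gamma_half. apply Gamma_le_add; lra. }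
  replace (bessel_struve_coef alpha n) with (g / sqrt PI * (m / d) * / INR (fact n)).
  2:{ unfold bessel_struve_coef. fold g m d. field. lra. }
  assert (Hgp : 0 < g / sqrt PI) by (apply Rdiv_lt_0_compat; lra).
  assert (Hfi := Rinv_0_lt_compat _ Hf).
  assert (Hmd : 0 <= m / d) by (apply Rdiv_le_0_compat; lra).
  split.
  - apply Rmult_le_pos; [apply Rmult_le_pos; lra | lra].
  - apply Rmult_le_compat_r; [lra|]. apply Rmult_le_compat_l; [lra|].
    apply Rle_div_l; [lra|].
    assert (sqrt PI * 1 <= sqrt PI * (/ exp (- 2) * d)).
    { apply Rmult_le_compat_l; [lra|]. rewrite Rmult_comm. apply Rle_div_r; lra. }
    unfold Rdiv in *. lra.
Qed.

Theorem theorem2p2 :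
  forall A B lambda alpha : R,
  3 - 2 * sqrt 2 <= B -> B < A -> A <= 1 ->
  let M := 2 * lambda * Gamma (alpha + 1) / (sqrt PI * Gamma (alpha + 1 / 2)) in
  Rmax 0 (Rabs lambda / 2 *
          Rabs ((lambda * (1 + A) * (1 + B) + M * (1 + B) ^ 2) / (A - B)))
    <= alpha ->
  let L := (A - B) *
    Rabs (alpha * lambda * (lambda * (A + B) + 2 * M * B)
          + 4 * B * lambda * (1 - B) / (1 + B) ^ 2
            * (lambda * (1 + A) + M * (1 + B))) in
  let E := (lambda * (1 - A * B) + M * (1 - B ^ 2)) ^ 2
    - (1 - B ^ 2) * (lambda * (1 - A) + M * (1 - B))
      * (lambda * (1 + A) + M * (1 + B)) in
  (L >= lambda ^ 2 / 2 * Rabs E /\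
   alpha ^ 2 * (A - B) ^ 2
   - lambda * (A - B)
     * Rabs (alpha * (lambda * (A + B) + 2 * M * B)
             + 4 * B * (1 - B) / (1 + B) ^ 2
               * (lambda * (1 + A) + M * (1 + B)))
   + 8 * alpha * (B * (1 - B) * (A - B) ^ 2 / (1 + B) ^ 3)
   >= 1 / 4
      * (lambda ^ 2 * (1 - A) * (1 - B) + lambda * M * (1 - B) ^ 2)
      * (lambda ^ 2 * (1 + A) * (1 + B) + lambda * M * (1 + B) ^ 2))
  \/
  (L <= lambda ^ 2 / 2 * Rabs E /\
   (alpha * (lambda * (A + B) + 2 * M * B)
    + 4 * B * (1 - B) / (1 + B) ^ 2
      * (lambda * (1 + A) + M * (1 + B))) ^ 2
   <= E * (alpha ^ 2 + 8 * alpha * B * ((1 - B) / (1 + B) ^ 3)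
           - ((lambda ^ 2 * (1 - A * B) + lambda * M * (1 - B ^ 2))
              / (2 * (A - B))) ^ 2)) ->
  (forall z : C, unit_disk z ->
     ((RtoC 1 + RtoC B) * bessel_struve alpha (RtoC lambda) z)%C
       <> (RtoC 1 + RtoC A)%C) ->
  janowski_class A B (bessel_struve alpha (RtoC lambda)).
Proof.
  intros A B lambda alpha HB HBA HA M Halpha L E _ Homit.
  assert (Ha : 0 <= alpha) by exact (Rle_trans _ _ _ (Rmax_l _ _) Halpha).
  assert (HB0 : 0 <= B).
  (* Since [(2 * sqrt 2)^2 = 8 < 9], the lower bound on [B] is positive. *)
  { assert (Hs := sqrt_sqrt 2 ltac:(lra)). assert (Hp := sqrt_pos 2). nra. }
  destruct (bessel_struve_coef_bounds alpha Ha) as [K HK].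
  apply janowski_of_nonneg_coef; try lra.
  - intros n. apply HK.
  - now apply bessel_struve_coef_0.
  (* The weighted coefficients are dominated by [K] times the exponential series at
     [3 * Rabs lambda]. *)
  - apply (@ex_series_le R_AbsRing R_CompleteNormedModule _
             (fun n => K * (/ INR (fact n) * (3 * Rabs lambda) ^ n))).
    + intros n. assert (Hl := pow_le _ n (Rabs_pos lambda)).
      assert (Hn := pow2_ge_0 (INR n)). destruct (HK n) as [H0 H1].
      change (Rabs ((1 + INR n ^ 2) * (bessel_struve_coef alpha n * Rabs lambda ^ n))
              <= K * (/ INR (fact n) * (3 * Rabs lambda) ^ n)).
      rewrite Rabs_pos_eq by (apply Rmult_le_pos; [lra | now apply Rmult_le_pos]).
      rewrite Rpow_mult_distr.
      replace (K * (/ INR (fact n) * (3 ^ n * Rabs lambda ^ n)))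
        with (3 ^ n * (K * / INR (fact n) * Rabs lambda ^ n)) by ring.
      apply Rmult_le_compat; [lra | apply Rmult_le_pos; lra | apply one_add_sqr_le_pow3 |].
      now apply Rmult_le_compat_r.
    + apply (ex_series_scal (V := R_NormedModule) K).
      exists (exp (3 * Rabs lambda)).
      apply (is_series_ext (fun n => scal ((3 * Rabs lambda) ^ n) (/ INR (fact n)))).
      { intros n. apply Rmult_comm. }
      eapply is_series_ext; [|apply (is_exp_Reals (3 * Rabs lambda))].
      intros n. simpl. now rewrite pow_n_pow.
  - exact Homit.
Qed.
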